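(* Let $j,k,n$ be integers with $1<j\le k<n$, let $D=\min(j,n-j)$, let $v=\{1,2,\dots,j\}$, and let $\rho$ be a non-negative integer with $\rho<D$. Let $P$ be a voter distribution on the $j$-element subsets of $[n]$ that is supported on the ball $B_\rho(v)$ in the Johnson graph $J(n,j)$. If $$\rho\le j\left[1-\frac{j}{k+1}\right],$$ then there exists a committee $C$ (a $k$-element subset of $[n]$) that satisfies at least $\binom{k-j}{\rho}\big/\binom{n-j}{\rho}$ of the voters, i.e. $$\pi_P(C)\ \ge\ \frac{\binom{k-j}{\rho}}{\binom{n-j}{\rho}}.$$
   Context: Candidates are identified with $[n]=\{1,2,\dots,n\}$. A list is a $j$-element subset of $[n]$; a committee is a $k$-element subset of $[n]$. A voter distribution $P$ is a probability distribution on the set of all lists; $P(\ell)$ is the fraction of voters who submitted list $\ell$. A committee satisfies a voter if it contains the voter's list, and the approval proportion (fraction of voters satisfied) of a committee $C$ is $\pi_P(C)=\sum_{\ell\subseteq C,\ |\ell|=j}P(\ell)$. The Johnson graph $J(n,j)$ has the lists as vertices, two lists being adjacent if they have exactly $j-1$ elements in common. Its graph distance $d$ satisfies $d(v,w)=m$ if and only if $|v\cap w|=j-m$, and its diameter is $D=\min(j,n-j)$. The ball of radius $r$ around a list $v$ is $B_r(v)=\{w \text{ a list} : d(v,w)\le r\}$. $P$ is supported on $B_\rho(v)$ if $P(\ell)=0$ for every list $\ell\notin B_\rho(v)$. Binomial coefficients $\binom{a}{b}$ with $0\le a<b$ are $0$. *)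

(* Defs.v *)
From HB Require Import structures.
From mathcomp Require Import all_boot all_order all_algebra.

Set Implicit Arguments.
Unset Strict Implicit.
Unset Printing Implicit Defensive.

Import Order.TTheory GRing.Theory Num.Theory.
Local Open Scope ring_scope.

(* The candidates 1, ..., n are the ordinals 0, ..., n-1 of 'I_n. *)
Notation ksubset n m := {A : {set 'I_n} | #|A| == m}.

(* The least length of an e-path from x to y. A shortest path has fewer than
   #|T| edges; if y is not reachable from x the value is #|T|. *)
Definition gdist (T : finType) (e : rel T) (x y : T) : nat :=
  find (fun m => [exists p : m.-tuple T, path e x p && (last x p == y)])
       (iota 0 #|T|).

Definition johnson (n j : nat) : rel (ksubset n j) :=
  fun v w => #|val v :&: val w| == j.-1.

Definition johnson_ball (n j r : nat) (v : ksubset n j) :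
    {set ksubset n j} :=
  [set w | (gdist (@johnson n j) v w <= r)%N].

Definition voter_distribution (R : realFieldType) (n j : nat)
    (P : ksubset n j -> R) : Prop :=
  (forall l, 0 <= P l) /\ \sum_l P l = 1.

Definition supported_on (R : realFieldType) (n j : nat)
    (P : ksubset n j -> R) (B : {set ksubset n j}) : Prop :=
  forall l, l \notin B -> P l = 0.

Definition approval (R : realFieldType) (n j k : nat)
    (P : ksubset n j -> R) (C : ksubset n k) : R :=
  \sum_(l : ksubset n j | val l \subset val C) P l.

(* Main.v *)
Require Import Defs.
From HB Require Import structures.
From mathcomp Require Import all_boot all_order all_algebra.
From mathcomp Require Import zify.

(** Average the approval over the committees that contain the centre [v] of the
    ball.  For a list [l] in the ball, the union of [v] and [l] has at most
    [j + rho] elements ([card_setU_ball]): a step in the Johnson graph replaces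
    a single candidate.  Passing to complements, the committees containing a
    set of [u] candidates are the [(n - k)]-subsets of a set of size [n - u]
    ([card_supersets]), so [l] is satisfied by at least [C(n - j - rho, n - k)]
    of the [C(n - j, n - k)] committees that contain [v].  Exchanging the two
    sums, the average approval over these committees is at least the quotient
    of the two numbers, and some committee reaches the average
    ([exists_ge_average]).  By the symmetry of trinomial coefficients
    ([mul_bin_trinomial]), this quotient is [C(k - j, rho) / C(n - j, rho)]. *)

Set Implicit Arguments.
Unset Strict Implicit.
Unset Printing Implicit Defensive.

Import Order.TTheory GRing.Theory Num.Theory.
Local Open Scope ring_scope.

(** Both sides are the trinomial coefficient [N! / (a! b! (N - a - b)!)] when
    [a + b <= N], and both vanish otherwise. *)
Lemma mul_bin_trinomial (N a b : nat) :
  ('C(N, a) * 'C(N - a, b) = 'C(N, b) * 'C(N - b, a))%N.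
Proof.
have [le_abN | lt_Nab] := leqP (a + b) N; last first.
  have vanish x y : (N < x + y)%N -> ('C(N, x) * 'C(N - x, y) = 0)%N.
    move=> lt_Nxy; have [lt_Nx | le_xN] := ltnP N x; first by rewrite bin_small.
    by rewrite ['C(N - x, y)]bin_small ?muln0 // ltn_subLR.
  by rewrite !vanish // addnC.
have facts_gt0 : (0 < a`! * b`! * (N - a - b)`!)%N by rewrite !muln_gt0 !fact_gt0.
apply/eqP; rewrite -(eqn_pmul2r facts_gt0).
have bin2_fact x y : (x + y <= N)%N ->
    ('C(N, x) * 'C(N - x, y) * (x`! * y`! * (N - x - y)`!) = N`!)%N.
  move=> le_xyN.
  have le_xN : (x <= N)%N by apply: leq_trans le_xyN; apply: leq_addr.
  have le_yN : (y <= N - x)%N by rewrite leq_subRL.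
  rewrite -(bin_fact le_xN) -(bin_fact le_yN) -!mulnA; congr (_ * _)%N.
  by rewrite mulnCA.
have le_baN : (b + a <= N)%N by rewrite addnC.
by rewrite bin2_fact // subnAC [(a`! * b`!)%N]mulnC bin2_fact.
Qed.

Lemma leq_bin_diff (n m : nat) : (0 < m <= n)%N -> (n - m < 'C(n, m))%N.
Proof.
elim: n m => [|n IHn] [|m] //= le_mn.
rewrite subSS binS; have [lt_mn | le_nm] := ltnP m n.
  have := IHn m.+1 lt_mn; have : (0 < 'C(n, m))%N by rewrite bin_gt0 ltnW.
  by lia.
by have : (0 < 'C(n, m))%N by [rewrite bin_gt0]; lia.
Qed.

(** Complementation turns the supersets of [U] into the subsets of [~: U]. *)
Lemma card_supersets (T : finType) (U : {set T}) (k : nat) : (k <= #|T|)%N ->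
  #|[set A : {set T} | (U \subset A) && (#|A| == k)]| =
    'C(#|T| - #|U|, #|T| - k).
Proof.
move=> le_kT; rewrite -(cardsC U) addKn -cards_draws.
rewrite -(card_imset _ (@setC_inj T)); apply: eq_card => B.
rewrite cardsC -[B]setCK mem_imset; last exact: setC_inj.
rewrite !inE setCS setCK; congr andb.
have := cardsC B; lia.
Qed.

Lemma card_committees_containing (n k : nat) (U : {set 'I_n}) : (k <= n)%N ->
  #|[set C : ksubset n k | U \subset val C]| = 'C(n - #|U|, n - k).
Proof.
move=> le_kn; have := @card_supersets 'I_n U k; rewrite card_ord => <- //.
rewrite -(card_imset _ val_inj); apply: eq_card => A; rewrite inE.
apply/imsetP/andP => [[C UC ->] | [UA cardA]].
  by split; [rewrite inE in UC | exact: (valP C)].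
by exists (Sub A cardA); rewrite ?inE SubK.
Qed.

(** Each edge of the Johnson graph moves one candidate in and one out. *)
Lemma card_setD_johnson_path (n j : nat) (x : ksubset n j)
    (p : seq (ksubset n j)) :
  path (@johnson n j) x p -> (#|val x :\: val (last x p)| <= size p)%N.
Proof.
elim: p x => [|y p IHp] x /=; first by rewrite setDv cards0.
case/andP=> /eqP xy /IHp le_yp.
have subD : val x :\: val (last y p) \subset
    (val x :\: val y) :|: (val y :\: val (last y p)).
  by apply/subsetP=> i; rewrite !inE => /andP[-> ->]; case: (i \in val y).
apply: leq_trans (subset_leq_card subD) _.
apply: leq_trans (leq_card_setU _ _) _; rewrite -add1n leq_add //.
rewrite cardsD xy (eqP (valP x)); lia.
Qed.

Lemma johnson_ball_path (n j r : nat) (v w : ksubset n j) :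
  (r < #|{: ksubset n j}|)%N -> w \in johnson_ball r v ->
  exists2 p, path (@johnson n j) v p & last v p = w /\ (size p <= r)%N.
Proof.
rewrite inE /gdist => lt_rT le_dr.
set d := find _ _ in le_dr.
have lt_d : (d < size (iota 0 #|{: ksubset n j}|))%N.
  by rewrite size_iota (leq_ltn_trans le_dr).
have := lt_d; rewrite -has_find => /(nth_find 0%N); rewrite -/d nth_iota.
  case/existsP=> p /andP[vp /eqP pw].
  by exists p => //; split=> //; rewrite size_tuple.
by rewrite size_iota in lt_d.
Qed.

(** The value [#|T|] that [gdist] gives to unreachable vertices exceeds the
    radius, since [r < n - j < C(n, j)]; so lists in the ball are reachable. *)
Lemma card_setU_ball (n j r : nat) (v w : ksubset n j) :
  (0 < j)%N -> (r < n - j)%N -> w \in johnson_ball r v ->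
  (#|val v :|: val w| <= j + r)%N.
Proof.
move=> j_gt0 lt_rnj w_ball.
have lt_rT : (r < #|{: ksubset n j}|)%N.
  rewrite card_sig -cardsE card_draws card_ord.
  by apply: (ltn_trans lt_rnj); apply: leq_bin_diff; lia.
have [p vp [pw le_pr]] := johnson_ball_path lt_rT w_ball.
have := card_setD_johnson_path vp; rewrite pw => le_D.
have := cardsUI (val v) (val w); have := cardsID (val w) (val v).
rewrite (eqP (valP w)); lia.
Qed.

Lemma exists_ge_average (R : realFieldType) (I : finType) (A : {set I})
    (F : I -> R) (a : R) :
  (0 < #|A|)%N -> a <= \sum_(i in A) F i ->
  exists2 i, i \in A & a / #|A|%:R <= F i.
Proof.
move=> A_gt0 le_aF.
have [/exists_inP // | /exists_inPn ltF] :=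
  boolP [exists i in A, a / #|A|%:R <= F i].
have [i0 Ai0] := card_gt0P A_gt0.
suff : \sum_(i in A) F i < a by rewrite ltNge le_aF.
have -> : a = \sum_(i in A) a / #|A|%:R.
  by rewrite sumr_const -[RHS]mulr_natr divfK // pnatr_eq0 -lt0n.
apply: ltr_sum => [|i /ltF]; last by rewrite -ltNge.
by apply/hasP; exists i0; rewrite ?mem_index_enum.
Qed.

Theorem theorem5p1 (R : realFieldType) (j k n rho : nat)
    (hj : (1 < j)%N) (hjk : (j <= k)%N) (hkn : (k < n)%N)
    (v : ksubset n j) (hv : val v = [set i : 'I_n | (i < j)%N])
    (hrho : (rho < minn j (n - j))%N)
    (P : ksubset n j -> R) (hP : voter_distribution P)
    (hsupp : supported_on P (johnson_ball rho v))
    (hbound : rho%:R <= j%:R * (1 - j%:R / k.+1%:R) :> R) :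
  exists C : ksubset n k,
    'C(k - j, rho)%:R / 'C(n - j, rho)%:R <= approval P C.
Proof.
have [P_ge0 P_sum1] := hP.
have lt_rho : (rho < n - j)%N by move: hrho; rewrite leq_min => /andP[].
have le_kn : (k <= n)%N := ltnW hkn.
pose A := [set C : ksubset n k | val v \subset val C].
have cardA : #|A| = 'C(n - j, n - k).
  by rewrite card_committees_containing // (eqP (valP v)).
have A_gt0 : (0 < #|A|)%N by rewrite cardA bin_gt0 leq_sub2l.
have le_sum : 'C(n - j - rho, n - k)%:R <= \sum_(C in A) approval P C.
  rewrite /approval (exchange_big_dep xpredT) //=.
  rewrite -[leLHS]mul1r -[X in X * _]P_sum1 mulr_suml; apply: ler_sum => l _.
  rewrite sumr_const -[leRHS]mulr_natr.
  have [l_ball | /hsupp->] := boolP (l \in johnson_ball rho v); last first.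
    by rewrite !mul0r.
  rewrite ler_wpM2l ?P_ge0 // ler_nat.
  rewrite (eq_card (B := [set C : ksubset n k | val v :|: val l \subset val C]));
    last by move=> C; rewrite [in RHS]inE subUset unfold_in inE.
  rewrite card_committees_containing //; apply: leq_bin2l.
  by rewrite -subnDA leq_sub2l // card_setU_ball // ltnW.
have [C _ leC] := exists_ge_average A_gt0 le_sum.
exists C; apply: le_trans leC; rewrite cardA.
have bin_neq0 m : (m <= n - j)%N -> 'C(n - j, m)%:R != 0 :> R.
  by rewrite pnatr_eq0 -lt0n bin_gt0.
suff -> : 'C(k - j, rho)%:R / 'C(n - j, rho)%:R =
    'C(n - j - rho, n - k)%:R / 'C(n - j, n - k)%:R :> R by [].
apply/eqP; rewrite eqr_div ?bin_neq0 ?leq_sub2l ?(ltnW lt_rho) //.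
rewrite -!natrM eqr_nat [eqbLHS]mulnC [eqbRHS]mulnC mul_bin_trinomial.
by rewrite [(n - j - (n - k))%N](_ : _ = k - j)%N //; lia.
Qed.
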